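(* Let $\mathbb{F}=\mathbb{R}$ or $\mathbb{C}$, let $A\in\mathbb{F}^{n\times n}$ be Hermitian and invertible, let $\mathcal{S}$ be a $p$-dimensional linear subspace of $\mathbb{F}^n$ with $1\le p\le n$, and let $\omega_{\min}:=-\lambda_{\min}(A)$. Let $\mathcal{X}_b$ ($b\in\mathbb{F}^n$), $\mathcal{X}$ and $\mathbf{D}_A:(\omega_{\min},\infty)\to\mathbb{F}^{n\times n}$ be the affine subspaces, the subspace and the map associated with $A$ and $\mathcal{S}$ as defined in the context. Then: (i) $\mathrm{Ind}_A(\mathcal{S})=0$ if and only if $\dim(\mathcal{X})=0$. (ii) $\mathrm{Ind}_A(\mathcal{S})=0$ if and only if $\dim(\mathcal{X}_b)=0$ for all $b\in\mathbb{F}^n$. (iii) The map $\mathbf{D}_A$ is constant if $\mathrm{Ind}_A(\mathcal{S})=0$, and injective otherwise.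
   Context: $\mathrm{Ind}_A(\mathcal{S}):=\dim(\mathcal{S}+A\mathcal{S})-\dim(\mathcal{S})$. $\lambda_{\min}(A)$ is the smallest eigenvalue of $A$, and $A_\omega:=A+\omega I$, which is Hermitian positive definite for $\omega>\omega_{\min}$. For $b\in\mathbb{F}^n$, $\omega>\omega_{\min}$, $x_{b,\omega}:=\operatorname*{arg\,min}_{x\in\mathcal{S}}\|A_\omega^{-1/2}(b-Ax)\|_2$ (it exists and is unique). $\mathcal{X}_b$ is the affine hull of $\{x_{b,\omega}:\omega>\omega_{\min}\}$, and $\mathcal{X}:=\sum_{b\in\mathbb{F}^n}\overrightarrow{\mathcal{X}_b}$, where $\overrightarrow{\mathcal{X}_b}$ is the linear subspace parallel to $\mathcal{X}_b$; equivalently $\mathcal{X}=\operatorname{span}\{x_{b,\omega}-x_{b,\mu}: b\in\mathbb{F}^n,\ \omega,\mu>\omega_{\min}\}$. The map $\mathbf{D}_A$ is $\mathbf{D}_A(\omega)=V(V^*AA_\omega^{-1}AV)^{-1}V^*AA_\omega^{-1}$, where $V\in\mathbb{F}^{n\times p}$ is any matrix with orthonormal columns spanning $\mathcal{S}$ (the result does not depend on $V$); one has $x_{b,\omega}=\mathbf{D}_A(\omega)b$. *)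

(* Defs.v *)
From mathcomp Require Import all_boot all_order all_algebra.
From mathcomp Require Import boolp classical_sets reals.
From mathcomp Require Import complex.

Set Implicit Arguments.
Unset Strict Implicit.
Unset Printing Implicit Defensive.

Import Order.TTheory GRing.Theory Num.Theory.
Local Open Scope classical_set_scope.
Local Open Scope ring_scope.

(* The alternative "F = R or F = C". *)
Inductive base_field := RealField | ComplexField.

Definition scalars (R : realType) (K : base_field) : numFieldType :=
  match K with RealField => R | ComplexField => R[i] end.

Definition of_real (R : realType) (K : base_field) :
    {rmorphism R -> scalars R K} :=
  match K return {rmorphism R -> scalars R K} with
  | RealField => idfun
  | ComplexField => real_complex R
  end.

Definition conj_scalars (R : realType) (K : base_field) :
    {rmorphism scalars R K -> scalars R K} :=
  match K return {rmorphism scalars R K -> scalars R K} with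
  | RealField => idfun
  | ComplexField => @conjc R
  end.

(* The absolute value as an element of R: on R[i], the library norm `|z| lives
   in R[i]. *)
Definition modulus (R : realType) (K : base_field) : scalars R K -> R :=
  match K return scalars R K -> R with
  | RealField => fun x => `|x|
  | ComplexField => @Normc.normc R
  end.

Section Subspaces.
Variables (F : fieldType) (vT : vectType F).
Implicit Types (E : set vT) (U : {vspace vT}).

(* The linear span of an arbitrary set: its smallest enclosing subspace. *)
Definition span_set E : {vspace vT} :=
  xget 0%VS [set U : {vspace vT} |
    (forall x, E x -> x \in U) /\
    forall W : {vspace vT}, (forall x, E x -> x \in W) -> (U <= W)%VS].

(* The sum of a possibly infinite family is the span of its union. *)
Definition sum_subspaces (I : Type) (U : I -> {vspace vT}) : {vspace vT} :=
  span_set [set x : vT | exists i, x \in U i].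

Definition affine_hull E : set vT :=
  [set x | exists (m : nat) (c : 'I_m -> F) (v : 'I_m -> vT),
      [/\ forall i, E (v i), \sum_i c i = 1 & x = \sum_i c i *: v i]].

(* For an affine subspace E, this is the linear subspace parallel to E. *)
Definition direction E : {vspace vT} :=
  span_set [set u | exists x y, [/\ E x, E y & u = x - y]].

Definition affine_dim E : nat := \dim (direction E).

End Subspaces.

Section Setting.
Variables (R : realType) (K : base_field).
Local Notation F := (scalars R K).

Definition adjmx m n (M : 'M[F]_(m, n)) : 'M[F]_(n, m) :=
  map_mx (conj_scalars R K) M^T.

Definition norm2 n (x : 'cV[F]_n) : R :=
  Num.sqrt (\sum_i modulus (x i 0) ^+ 2).

Section Matrices.
Variable n : nat.
Implicit Types (A M N V : 'M[F]_n) (S : {vspace 'cV[F]_n}) (b x : 'cV[F]_n).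

Definition is_hermitian M : Prop := adjmx M = M.

(* On R[i], 0 <= z means that z is real and nonnegative. *)
Definition is_psd M : Prop :=
  is_hermitian M /\ forall x, 0 <= (adjmx x *m M *m x) 0 0.

(* The square root of a positive semidefinite matrix; like lambda_min and x_opt
   below, it has a default value outside the case of (unique) existence. *)
Definition sqrtmx M : 'M[F]_n := xget 0 [set N | is_psd N /\ N *m N = M].

(* For a Hermitian matrix, eigenvalues are real, so they are comparable even in
   the partial order of R[i].  MathComp eigenvalues refer to row eigenvectors;
   the set of eigenvalues is the same as for column eigenvectors. *)
Definition lambda_min A : R :=
  xget 0 [set l : R | eigenvalue A (of_real R K l) /\
                      forall z : F, eigenvalue A z -> of_real R K l <= z].

Definition omega_min A : R := - lambda_min A.

Definition shiftmx A (w : R) : 'M[F]_n := A + (of_real R K w)%:M.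

Definition image_subspace A S : {vspace 'cV[F]_n} :=
  (linfun (mulmx A : 'cV[F]_n -> 'cV[F]_n) @: S)%VS.

(* The subtraction in nat is exact, since S is contained in S + A S. *)
Definition Ind A S : nat := (\dim (S + image_subspace A S)%VS - \dim S)%N.

Definition residual_norm A b w x : R :=
  norm2 (invmx (sqrtmx (shiftmx A w)) *m (b - A *m x)).

Definition x_opt A S b w : 'cV[F]_n :=
  xget 0 [set x | x \in S /\
                  forall y, y \in S ->
                    residual_norm A b w x <= residual_norm A b w y].

Definition X_aff A S b : set 'cV[F]_n :=
  affine_hull [set x_opt A S b w | w in [set w | omega_min A < w]].

Definition X_lin A S : {vspace 'cV[F]_n} :=
  sum_subspaces (fun b : 'cV[F]_n => direction (X_aff A S b)).

End Matrices.

Definition orthonormal_basis_mx n p (S : {vspace 'cV[F]_n})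
    (V : 'M[F]_(n, p)) : Prop :=
  adjmx V *m V = 1%:M /\ <<[seq col j V | j : 'I_p]>>%VS = S.

Definition D_map n p (A : 'M[F]_n) (V : 'M[F]_(n, p)) (w : R) : 'M[F]_n :=
  V *m invmx (adjmx V *m A *m invmx (shiftmx A w) *m A *m V)
    *m adjmx V *m A *m invmx (shiftmx A w).

End Setting.

(* Main.v *)
(* For a basis matrix V of S, minimising the residual over S is a least-squares
   problem with Gram matrix V^* A A_w^-1 A V, which is invertible since A_w is
   positive definite, so the minimiser of index b is D_A(w) b.
   Ind_A(S) = 0 means that A S is contained in S, i.e. A V = V T for some T; then
   V^* A A_w^-1 = C V^* with C invertible, C cancels in D_A(w), and the shift
   disappears. Conversely, if D_A(w) = D_A(u) with w <> u, cancelling V and A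
   leaves V^* A_u = C V^* A_w, that is (1 - C) V^* A = (w C - u) V^*. A left null
   vector y of 1 - C satisfies (w - u) y V^* = 0, so 1 - C is invertible and S is
   A-invariant.
   The spectral facts on A are read off its complexification; the square root of
   A_w is a real polynomial in A_w, hence it exists over the real field as well. *)

Require Import Defs.
From mathcomp Require Import all_boot all_order all_algebra.
From mathcomp Require Import boolp classical_sets reals.
From mathcomp Require Import sesquilinear spectral complex.

Set Implicit Arguments.
Unset Strict Implicit.
Unset Printing Implicit Defensive.

Import Order.TTheory GRing.Theory Num.Theory.
Local Open Scope ring_scope.

(** * The two base fields and their common embedding into [R[i]] *)

Section Scalars.
Variables (R : realType) (K : base_field).
Local Notation F := (scalars R K).

(** Spectral facts are proved over [R[i]] for both fields at once and reflected back along this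
    injective, order-preserving embedding. *)
Definition to_complex : {rmorphism F -> R[i]} :=
  match K return {rmorphism scalars R K -> R[i]} with
  | RealField => real_complex R
  | ComplexField => idfun
  end.

Lemma conj_scalarsK : involutive (@conj_scalars R K).
Proof. by case: K => x //=; exact: conjcK. Qed.

Lemma conj_of_real x : conj_scalars R K (of_real R K x) = of_real R K x.
Proof. by case: K => //=; rewrite oppr0. Qed.

Lemma to_complex_conj x : to_complex (conj_scalars R K x) = conjc (to_complex x).
Proof. by move: x; rewrite /to_complex; case: K => x //=; rewrite oppr0. Qed.

Lemma to_complex_real x : to_complex (of_real R K x) = real_complex R x.
Proof. by rewrite /to_complex; case: K. Qed.

Lemma ler_to_complex x y : (to_complex x <= to_complex y) = (x <= y).
Proof. by move: x y; rewrite /to_complex; case: K => x y //=; rewrite lecR. Qed.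

Lemma ler_of_real x y : (of_real R K x <= of_real R K y) = (x <= y).
Proof. by rewrite -ler_to_complex !to_complex_real lecR. Qed.

Lemma sqr_modulus x :
  of_real R K (modulus x ^+ 2) = conj_scalars R K x * x.
Proof.
move: x; case: K => [x|x] /=; first by rewrite real_normK ?num_real.
by rewrite mulrC -sqr_normc !rmorphXn.
Qed.

End Scalars.

(** * Adjoints and squared Euclidean norms *)

Section Adjoint.
Variables (R : realType) (K : base_field).
Local Notation F := (scalars R K).

Lemma adjmxM m n q (M : 'M[F]_(m, n)) (N : 'M[F]_(n, q)) :
  adjmx (M *m N) = adjmx N *m adjmx M.
Proof. by rewrite /adjmx trmx_mul map_mxM. Qed.

Lemma adjmxK m n (M : 'M[F]_(m, n)) : adjmx (adjmx M) = M.
Proof. by apply/matrixP => i j; rewrite !mxE conj_scalarsK. Qed.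

Lemma adjmx0 m n : adjmx (0 : 'M[F]_(m, n)) = 0.
Proof. by rewrite /adjmx trmx0 map_mx0. Qed.

Lemma adjmxD m n (M N : 'M[F]_(m, n)) : adjmx (M + N) = adjmx M + adjmx N.
Proof. by rewrite /adjmx raddfD map_mxD. Qed.

Lemma adjmx_real_scalar n (r : R) :
  adjmx ((of_real R K r)%:M : 'M[F]_n) = (of_real R K r)%:M.
Proof. by rewrite /adjmx tr_scalar_mx map_scalar_mx /= conj_of_real. Qed.

Lemma adjmxV n (M : 'M[F]_n) : adjmx (invmx M) = invmx (adjmx M).
Proof. by rewrite /adjmx trmx_inv map_invmx. Qed.

Lemma hermitian_shiftmx n (A : 'M[F]_n) w :
  is_hermitian A -> is_hermitian (shiftmx A w).
Proof. by rewrite /is_hermitian adjmxD adjmx_real_scalar => ->. Qed.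

Lemma hermitian_invmx n (M : 'M[F]_n) : is_hermitian M -> is_hermitian (invmx M).
Proof. by rewrite /is_hermitian adjmxV => ->. Qed.

Definition sqnorm n (x : 'cV[F]_n) : R := \sum_i modulus (x i 0) ^+ 2.

Lemma sqnormE n (x : 'cV[F]_n) : of_real R K (sqnorm x) = (adjmx x *m x) 0 0.
Proof.
by rewrite rmorph_sum !mxE; apply: eq_bigr => i _; rewrite !mxE sqr_modulus.
Qed.

Lemma sqnorm_ge0 n (x : 'cV[F]_n) : 0 <= sqnorm x.
Proof. by apply: sumr_ge0 => i _; exact: sqr_ge0. Qed.

Lemma sqnorm_eq0 n (x : 'cV[F]_n) : sqnorm x = 0 -> x = 0.
Proof.
move=> /eqP; rewrite psumr_eq0 => [/allP x0|i _]; last exact: sqr_ge0.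
apply/colP => i; rewrite mxE.
have := x0 i (mem_index_enum i) => /eqP m0.
have := sqr_modulus (x i 0); rewrite m0 rmorph0 => /esym/eqP.
by rewrite mulf_eq0 fmorph_eq0 orbb => /eqP.
Qed.

Lemma sqnormD n (x y : 'cV[F]_n) :
  adjmx x *m y = 0 -> sqnorm (x + y) = sqnorm x + sqnorm y.
Proof.
move=> xy0; have yx0 : adjmx y *m x = 0.
  by rewrite -[LHS]adjmxK adjmxM adjmxK xy0 adjmx0.
apply: (fmorph_inj (of_real R K)); rewrite rmorphD !sqnormE.
by rewrite adjmxD mulmxDl !mulmxDr xy0 yx0 addr0 add0r mxE.
Qed.

Lemma norm2_le n (x y : 'cV[F]_n) : (norm2 x <= norm2 y) = (sqnorm x <= sqnorm y).
Proof. by rewrite /norm2 ler_sqrt ?sqnorm_ge0. Qed.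

(** Multiplying on the left by the adjoint of [c] turns the hypothesis into the vanishing of the
    squared norm of [Q c]. *)
Lemma gram_mulmx_eq0 n q (Q : 'M[F]_(n, q)) (c : 'cV[F]_q) :
  adjmx Q *m Q *m c = 0 -> Q *m c = 0.
Proof.
move=> Qc0; apply: sqnorm_eq0; apply: (fmorph_inj (of_real R K)).
by rewrite sqnormE rmorph0 adjmxM -!mulmxA (mulmxA (adjmx Q)) Qc0 mulmx0 mxE.
Qed.

Lemma unitmx_inj n (M : 'M[F]_n) :
  (forall c : 'cV[F]_n, M *m c = 0 -> c = 0) -> M \in unitmx.
Proof.
move=> injM; rewrite -unitmx_tr -row_free_unit -kermx_eq0.
apply/eqP/row_matrixP => i; rewrite row0 -[LHS]trmxK.
rewrite [(row i _)^T]injM ?trmx0 // -[LHS]trmxK trmx_mul trmxK.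
by rewrite -row_mul mulmx_ker row0 trmx0.
Qed.

End Adjoint.

(** Newton interpolation, one node at a time. Nodes may repeat as long as the values agree, as
    happens with multiple eigenvalues. *)
Lemma ex_interpolation (F : fieldType) (I : finType) (x y : I -> F) :
  (forall i j, x i = x j -> y i = y j) ->
  exists q : {poly F}, forall i, q.[x i] = y i.
Proof.
move=> yx; have [q qP] : exists q : {poly F}, forall i, i \in enum I -> q.[x i] = y i.
  elim: (enum I) => [|i s [q qP]]; first by exists 0.
  have [/mapP[j js xij]|xi] := boolP (x i \in map x s).
    by exists q => k; rewrite inE => /predU1P[->|/qP//]; rewrite xij qP //; apply: yx.
  (* [r] vanishes at the earlier nodes but not at the new one, so a multiple of it corrects [q]
     there without spoiling earlier values. *)
  pose r := \prod_(j <- s) ('X - (x j)%:P).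
  have ri : r.[x i] != 0.
    apply: contra xi; rewrite horner_prod prodf_seq_eq0 => /hasP[j js] /=.
    by rewrite hornerXsubC subr_eq0 => /eqP->; exact: map_f.
  have rs j : j \in s -> r.[x j] = 0.
    move=> js; rewrite horner_prod (big_rem j) //= hornerXsubC subrr.
    by rewrite mul0r.
  exists (q + ((y i - q.[x i]) / r.[x i])%:P * r) => j.
  rewrite hornerD hornerM hornerC inE => /predU1P[->|js].
    by rewrite divfK // addrC subrK.
  by rewrite (rs j js) mulr0 addr0 qP.
by exists q => i; rewrite qP ?mem_enum.
Qed.

(** * Unitary diagonalisation, smallest eigenvalue and square root *)

Section Spectrum.
Variables (R : realType) (K : base_field).
Local Notation F := (scalars R K).
Local Notation C := (R[i]).
Local Notation toC := (@to_complex R K).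

Definition cadj m n (M : 'M[C]_(m, n)) : 'M[C]_(n, m) := map_mx (@conjc R) M^T.

Lemma map_adjmx m n (M : 'M[F]_(m, n)) : map_mx toC (adjmx M) = cadj (map_mx toC M).
Proof. by apply/matrixP => i j; rewrite !mxE to_complex_conj. Qed.

Lemma cadjM m n q (M : 'M[C]_(m, n)) (N : 'M[C]_(n, q)) :
  cadj (M *m N) = cadj N *m cadj M.
Proof. by rewrite /cadj trmx_mul map_mxM. Qed.

Lemma cadjK m n (M : 'M[C]_(m, n)) : cadj (cadj M) = M.
Proof. by apply/matrixP => i j; rewrite !mxE conjcK. Qed.

Definition real_diag n (d : 'I_n -> R) : 'M[C]_n :=
  diag_mx (\row_i real_complex R (d i)).

Lemma cadj_real_diag n (d : 'I_n -> R) : cadj (real_diag d) = real_diag d.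
Proof.
rewrite /cadj tr_diag_mx map_diag_mx; congr diag_mx.
by apply/rowP => i; rewrite !mxE /= oppr0.
Qed.

(** [P] is complex even when [A] is real. Its rows are left eigenvectors of the complexified [A]. *)
Definition diagonalized n (A : 'M[F]_n) (P : 'M[C]_n) (d : 'I_n -> R) :=
  [/\ P *m cadj P = 1%:M, cadj P *m P = 1%:M
    & map_mx toC A = cadj P *m real_diag d *m P].

Lemma hermitian_diagonalized n (A : 'M[F]_n) :
  is_hermitian A -> exists P d, diagonalized A P d.
Proof.
move=> hA; pose B := map_mx toC A.
have hB : B \is hermitianmx _ false (@Num.conj C).
  apply/is_hermitianmxP; rewrite expr0 scale1r.
  by rewrite -[X in X = _](congr1 (map_mx toC) hA) map_adjmx.
have uP := spectral_unitarymx B.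
exists (spectralmx B), (fun i => complex.Re (spectral_diag B 0 i)).
have PP := unitarymxP uP; split => //; first exact: mulmx1C.
have BE := orthomx_spectralP (hermitian_normalmx hB).
rewrite (invmx_unitary uP) in BE.
(* The eigenvalues of a Hermitian matrix are real, so taking real parts loses nothing. *)
have dE : \row_i real_complex R (complex.Re (spectral_diag B 0 i)) = spectral_diag B.
  apply/rowP => i; rewrite mxE RRe_real //.
  by have /mxOverP := hermitian_spectral_diag_real hB; apply.
by rewrite /real_diag dE.
Qed.

Section Diagonalized.
Variables (n : nat) (A : 'M[F]_n) (P : 'M[C]_n) (d : 'I_n -> R).
Hypothesis dA : diagonalized A P d.

Lemma eigenvalue_diagonalized i : eigenvalue A (of_real R K (d i)).
Proof.
have [PP' P'P AE] := dA; rewrite -(eigenvalue_map toC) to_complex_real.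
apply/eigenvalueP; exists (row i P).
  rewrite AE -row_mul !mulmxA PP' mul1mx row_mul row_diag_mx mxE.
  by rewrite -scalemxAl -rowE.
apply/eqP => Pi0; have /rowP/(_ i) := congr1 (row i) PP'.
by rewrite row_mul Pi0 mul0mx !mxE eqxx => /eqP; rewrite eq_sym oner_eq0.
Qed.

(** In the coordinates [v P^*] a left eigenvector [v] is an eigenvector of the diagonal matrix; any
    nonzero coordinate identifies the eigenvalue. *)
Lemma diagonalized_eigenvalue z :
  eigenvalue A z -> exists i, z = of_real R K (d i).
Proof.
have [PP' P'P AE] := dA.
rewrite -(eigenvalue_map toC) => /eigenvalueP[v vA v0].
have [i wi|w0] := pickP (fun i => (v *m cadj P) 0 i != 0); last first.
  case/eqP: v0; rewrite -[v]mulmx1 -P'P mulmxA.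
  have -> : v *m cadj P = 0.
    by apply/rowP => i; rewrite [RHS]mxE; apply/eqP/negbFE/w0.
  exact: mul0mx.
exists i; apply: (fmorph_inj toC); rewrite to_complex_real.
have : v *m cadj P *m real_diag d = toC z *: (v *m cadj P).
  have := congr1 (mulmx^~ (cadj P)) vA; rewrite AE !mulmxA /=.
  by rewrite -[X in X = _]mulmxA PP' mulmx1 -scalemxAl.
move: wi; move: (v *m cadj P) => u wi /rowP/(_ i).
by rewrite mul_mx_diag !mxE mulrC => /(mulIf wi).
Qed.

Lemma diagonalized_shiftmx w : diagonalized (shiftmx A w) P (fun i => d i + w).
Proof.
have [PP' P'P AE] := dA; split=> //.
rewrite /shiftmx map_mxD AE map_scalar_mx /= to_complex_real.
have -> : real_diag (fun i => d i + w) = real_diag d + (real_complex R w)%:M.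
  rewrite /real_diag -diag_const_mx -raddfD; congr diag_mx.
  by apply/rowP => i; rewrite !mxE rmorphD.
rewrite mulmxDr mulmxDl; congr (_ + _).
by rewrite mul_mx_scalar -scalemxAl P'P scalemx1.
Qed.

(** The quadratic form at [x] is the sum of the [d i] times the squared moduli of the coordinates of
    [P x]. *)
Lemma diagonalized_psd : (forall i, 0 <= d i) -> is_psd A.
Proof.
have [_ _ AE] := dA => d_ge0; split=> [|x].
  apply: (@map_mx_inj _ _ toC); rewrite map_adjmx AE.
  by rewrite !cadjM cadjK cadj_real_diag mulmxA.
rewrite -(ler_to_complex (K := K)) rmorph0.
have -> : toC ((adjmx x *m A *m x) 0 0) = (map_mx toC (adjmx x *m A *m x)) 0 0.
  by rewrite [RHS]mxE.
rewrite !map_mxM AE map_adjmx; set y := map_mx toC x.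
rewrite !mulmxA -cadjM -!mulmxA mulmxA mul_mx_diag !mxE.
apply: sumr_ge0 => i _; rewrite !mxE mulrAC mulr_ge0 ?ler0c //.
by rewrite mulrC mulcJ_ge0.
Qed.

End Diagonalized.

Lemma lambda_min_le n (A : 'M[F]_n) z :
  is_hermitian A -> eigenvalue A z -> of_real R K (lambda_min A) <= z.
Proof.
move=> hA Az; have [P [d dA]] := hermitian_diagonalized hA.
(* The given eigenvalue supplies an index, so the minimum below is over a nonempty family; it shows
   that the set defining [lambda_min] is inhabited. *)
have [i _] := diagonalized_eigenvalue dA Az.
pose m := [arg min_(j < i) d j]%O.
suff : exists l, eigenvalue A (of_real R K l) /\
    forall z : F, eigenvalue A z -> of_real R K l <= z.
  by case=> l lP; rewrite /lambda_min; case: xgetP => [? _ [_]|/(_ l)]; [apply|case].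
exists (d m); split; first exact: eigenvalue_diagonalized dA _.
move=> _ /(diagonalized_eigenvalue dA)[j ->]; rewrite ler_of_real.
by rewrite /m; case: Order.TotalTheory.arg_minP => // k _; apply.
Qed.

(** A singular shift would make [- w] an eigenvalue of [A], hence at least [lambda_min A]. *)
Lemma shiftmx_unit n (A : 'M[F]_n) w :
  is_hermitian A -> omega_min A < w -> shiftmx A w \in unitmx.
Proof.
move=> hA wA; rewrite -row_free_unit -kermx_eq0; apply: contraTT wA => k0.
have : eigenvalue A (of_real R K (- w)).
  by rewrite /eigenvalue /eigenspace rmorphN raddfN opprK.
by move/(lambda_min_le hA); rewrite ler_of_real -leNgt lerNr.
Qed.

Lemma sqrtmx_shiftmx n (A : 'M[F]_n) w (N := sqrtmx (shiftmx A w)) :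
  is_hermitian A -> omega_min A < w -> is_hermitian N /\ N *m N = shiftmx A w.
Proof.
move=> hA wA; have [P [d dA]] := hermitian_diagonalized hA.
(* [xget] returns a member of its set as soon as there is one, so exhibiting a single root is
   enough. *)
suff [N1 N1P] : exists N1 : 'M[F]_n, is_psd N1 /\ N1 *m N1 = shiftmx A w.
  by rewrite /N /sqrtmx; case: xgetP => [? _ [[]]|/(_ N1)] //; case.
have [PP' P'P ME] := diagonalized_shiftmx dA w.
have Mge0 i : 0 <= d i + w.
  rewrite addrC -lerBlDr sub0r ltW // (le_lt_trans _ wA) // lerN2.
  rewrite -(@ler_of_real R K).
  exact: lambda_min_le (eigenvalue_diagonalized dA i).
have [q qP] : exists q : {poly R}, forall i, q.[d i + w] = Num.sqrt (d i + w).
  by apply: ex_interpolation => i j ->.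
(* Evaluating a polynomial at a matrix takes place in the ring of matrices of positive size; in size
   0 the zero matrix is a root. *)
case: n => [|n] in A N hA wA P d dA PP' P'P ME Mge0 qP *.
  exists 0; split; last by apply/matrixP => -[].
  split; first by apply/matrixP => -[].
  by move=> x; rewrite mulmx0 mul0mx mxE.
(* The coefficients of [q] are real, so [N1] has entries in the base field itself, whichever it
   is. *)
pose N1 := horner_mx (shiftmx A w) (map_poly (of_real R K) q).
have dN1 : diagonalized N1 P (fun i => Num.sqrt (d i + w)).
  split=> //; rewrite map_horner_mx ME -map_poly_comp.
  have uP : P \in unitmx by case/mulmx1_unit: PP'.
  have P'E : cadj P = invmx P.
    by rewrite -[LHS]mul1mx -(mulVmx uP) -mulmxA PP' mulmx1.
  rewrite P'E (horner_mx_uconjC _ _ uP) horner_mx_diag.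
  have -> // : map_mx (horner (map_poly (toC \o of_real R K) q))
      (\row_i real_complex R (d i + w)) = \row_i real_complex R (Num.sqrt (d i + w)).
  apply/rowP => i; rewrite !mxE -qP (eq_map_poly (@to_complex_real R K)).
  by rewrite horner_map.
exists N1; split; first by apply: diagonalized_psd dN1 _ => i; exact: sqrtr_ge0.
have [_ _ N1E] := dN1; apply: (@map_mx_inj _ _ toC).
rewrite map_mxM N1E ME !mulmxA -[_ *m P *m cadj P]mulmxA PP' mulmx1.
have dE : real_diag (fun i => Num.sqrt (d i + w)) *m
    real_diag (fun i => Num.sqrt (d i + w)) = real_diag (fun i => d i + w).
  rewrite /real_diag mulmx_diag; congr diag_mx.
  by apply/rowP => i; rewrite !mxE -rmorphM -expr2 sqr_sqrtr.
by rewrite -[_ *m real_diag _ *m real_diag _]mulmxA dE.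
Qed.
End Spectrum.

(** * Spans, directions and affine hulls that reduce to zero *)

Section Hulls.
Variables (F : fieldType) (vT : vectType F).
Local Open Scope classical_set_scope.
Implicit Types (E : set vT).

(** Take an enclosing subspace [U] of minimal dimension. For any enclosing [W], the intersection of
    [U] and [W] still encloses [E], so by minimality it is [U]. *)
Lemma span_setP E :
  (forall x, E x -> x \in span_set E) /\
  (forall W : {vspace vT}, (forall x, E x -> x \in W) -> (span_set E <= W)%VS).
Proof.
pose encloses (d : nat) := `[< exists U : {vspace vT},
  \dim U = d /\ forall x, E x -> x \in U >].
have ex_d : exists d, encloses d.
  by exists (\dim {:vT}); apply/asboolP; exists fullv; split=> // x _; rewrite memvf.
have [d /asboolP[U [dU EU]] d_min] := ex_minnP ex_d.
rewrite /span_set; case: xgetP => [W _ //|/(_ U)[]]; split=> // W EW.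
apply/capv_idPl/eqP; rewrite eqEdim capvSl dU d_min //.
apply/asboolP; exists (U :&: W)%VS; split=> // x Ex.
by rewrite memv_cap EU ?EW.
Qed.

Lemma span_set_eq0 E : span_set E = 0%VS <-> forall x, E x -> x = 0.
Proof.
have [Esub minE] := span_setP E; split=> [E0 x /Esub|E0].
  by rewrite E0 memv0 => /eqP.
by apply/eqP; rewrite -subv0; apply: minE => x /E0->; exact: mem0v.
Qed.

Lemma direction_eq0 E :
  direction E = 0%VS <-> forall x y, E x -> E y -> x = y.
Proof.
rewrite /direction span_set_eq0; split=> [E0 x y Ex Ey|E1 _ [x [y [Ex Ey ->]]]].
  by apply/eqP; rewrite -subr_eq0; apply/eqP/E0; exists x, y.
by rewrite (E1 x y) ?subrr.
Qed.

Lemma sub_affine_hull E : E `<=` affine_hull E.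
Proof.
move=> x Ex; exists 1%N, (fun=> 1), (fun=> x).
by rewrite !big_ord1 scale1r.
Qed.

Lemma direction_affine_hull_eq0 E :
  direction (affine_hull E) = 0%VS <-> forall x y, E x -> E y -> x = y.
Proof.
rewrite direction_eq0; split=> [E1 x y Ex Ey|E1].
  by apply: E1; exact: sub_affine_hull.
move=> x y [m [c [v [Ev c1 xE]]]] [m' [c' [v' [Ev' c1' yE]]]].
(* An empty combination has coefficient sum 0, not 1. Hence [v ord0] exists; all points equal it,
   and both combinations collapse to it. *)
case: m => [|m] in c v Ev c1 xE *.
  by move/eqP: c1; rewrite big_ord0 eq_sym oner_eq0.
have vE i : v i = v ord0 by apply: E1.
have v'E i : v' i = v ord0 by apply: E1.
rewrite xE yE (eq_bigr _ (fun i _ => congr1 ( *:%R (c i)) (vE i))).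
rewrite [RHS](eq_bigr _ (fun i _ => congr1 ( *:%R (c' i)) (v'E i))).
by rewrite -!scaler_suml c1 c1'.
Qed.

Lemma sum_subspaces_eq0 (I : Type) (U : I -> {vspace vT}) :
  sum_subspaces U = 0%VS <-> forall i, U i = 0%VS.
Proof.
rewrite /sum_subspaces span_set_eq0; split=> [U0 i|U0 x [j xj]].
  apply/eqP; rewrite -subv0; apply/subvP => x xU.
  by rewrite memv0; apply/eqP/U0; exists i.
by move: xj; rewrite U0 memv0 => /eqP.
Qed.

End Hulls.

(** * Least squares: the minimiser is given by [D_map] *)

Section Optimum.
Variables (R : realType) (K : base_field) (n p : nat).
Local Notation F := (scalars R K).
Implicit Types (A : 'M[F]_n) (S : {vspace 'cV[F]_n}) (V : 'M[F]_(n, p)).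

(** The arguments below run for any basis matrix: [ex_basis_mx] provides one for (i) and (ii), and
    the orthonormal [V] of (iii) is one. *)
Definition basis_mx S V : Prop :=
  (forall y, y \in S <-> exists c, y = V *m c) /\
  (forall c : 'cV[F]_p, V *m c = 0 -> c = 0).

Lemma ex_basis_mx S : \dim S = p -> exists V, basis_mx S V.
Proof.
move=> dS; pose V : 'M[F]_(n, p) := \matrix_(i, j) (vbasis S)`_j i 0.
have VE c : V *m c = \sum_(j < p) c j 0 *: (vbasis S)`_j.
  apply/colP => i; rewrite summxE !mxE; apply: eq_bigr => j _.
  by rewrite !mxE mulrC.
have bS : basis_of S (vbasis S) := vbasisP S.
(* The basis is retyped as a [p]-tuple, so that its indices match the columns of [V]. *)
have : size (vbasis S) == p by rewrite size_tuple dS.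
move: bS VE; move: (vbasis S : seq _) => s bs VE sp.
have {}bs : basis_of S (Tuple sp) := bs.
have {}VE c : V *m c = \sum_(j < p) c j 0 *: (Tuple sp)`_j := VE c.
exists V; split=> [y|c].
  split=> [yS|[c ->]].
    exists (\col_j coord (Tuple sp) j y); rewrite VE.
    rewrite {1}(coord_basis bs yS).
    by apply: eq_bigr => j _; rewrite mxE.
  rewrite VE; apply: memv_suml => j _; apply: memvZ.
  by apply: (basis_mem bs); rewrite mem_nth ?(eqP sp).
rewrite VE => /(freeP (basis_free bs)) c0.
by apply/colP => j; rewrite mxE c0.
Qed.

Lemma orthonormal_basis_mxW S V : orthonormal_basis_mx S V -> basis_mx S V.
Proof.
case=> VV <-; split=> [y|c Vc0]; last by rewrite -[c]mul1mx -VV -mulmxA Vc0 mulmx0.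
have VE (c : 'cV[F]_p) : V *m c = \sum_(j < p) c j 0 *: col j V.
  apply/colP => i; rewrite summxE !mxE; apply: eq_bigr => j _.
  by rewrite !mxE mulrC.
split=> [|[c ->]]; last first.
  rewrite VE; apply: memv_suml => j _.
  by apply/memvZ/memv_span/mapP; exists j; rewrite ?mem_enum.
have -> : <<[seq col j V | j : 'I_p]>>%VS = (\sum_(j < p) <[col j V]>)%VS.
  by rewrite span_def big_image.
case/memv_sumP => v vV ->.
have /fin_all_exists[c cE] j : exists c, v j = c *: col j V by apply/vlineP/vV.
exists (\col_j c j); rewrite VE; apply: eq_bigr => j _.
by rewrite cE mxE.
Qed.

Section FixedShift.
Variables (A : 'M[F]_n) (S : {vspace 'cV[F]_n}) (V : 'M[F]_(n, p)) (w : R).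
Hypotheses (hA : is_hermitian A) (uA : A \in unitmx) (bV : basis_mx S V).
Hypothesis wA : omega_min A < w.

Let N := sqrtmx (shiftmx A w).
Let Q := invmx N *m A *m V.

Lemma sqrtmx_unit : N \in unitmx.
Proof.
have [_ NN] := sqrtmx_shiftmx hA wA.
by have := shiftmx_unit hA wA; rewrite -NN unitmx_mul => /andP[].
Qed.

Lemma adjmx_invmx_sqrtmx : adjmx (invmx N) = invmx N.
Proof. exact: hermitian_invmx (sqrtmx_shiftmx hA wA).1. Qed.

Lemma invmx_sqrtmxK : invmx N *m invmx N = invmx (shiftmx A w).
Proof.
have [_ <-] := sqrtmx_shiftmx hA wA.
have uN := sqrtmx_unit; apply: (can_inj (mulKmx uN)); apply: (can_inj (mulKmx uN)).
by rewrite mulKVmx // mulmxV // (mulmxA N N) mulmxV // unitmx_mul uN.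
Qed.

Lemma gramE : adjmx V *m A *m invmx (shiftmx A w) *m A *m V = adjmx Q *m Q.
Proof. by rewrite !adjmxM adjmx_invmx_sqrtmx hA -invmx_sqrtmxK !mulmxA. Qed.

Lemma gram_unit :
  adjmx V *m A *m invmx (shiftmx A w) *m A *m V \in unitmx.
Proof.
rewrite gramE; apply: unitmx_inj => c /gram_mulmx_eq0 Qc0; apply: bV.2.
apply: (can_inj (mulKmx uA)); apply: (can_inj (mulKVmx sqrtmx_unit)).
by rewrite !mulmx0 -Qc0 /Q !mulmxA.
Qed.

(** The residual at [D_map A V w *m b] is orthogonal to [A S] for the inner product of the inverse
    shift. *)
Lemma normal_equation (b : 'cV[F]_n) :
  adjmx V *m A *m invmx (shiftmx A w) *m (b - A *m (D_map A V w *m b)) = 0.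
Proof.
rewrite mulmxBr /D_map !mulmxA mulmxV ?gram_unit // mul1mx.
exact: subrr.
Qed.

Lemma D_map_mem (b : 'cV[F]_n) : D_map A V w *m b \in S.
Proof. by apply/bV.1; rewrite /D_map -!mulmxA; eexists. Qed.

(** Pythagoras: the adjoint of the normal equation makes the optimal residual orthogonal to the
    deviation within [A S]. *)
Lemma sqnorm_residual (b y : 'cV[F]_n) : y \in S ->
  sqnorm (invmx N *m (b - A *m y)) =
  sqnorm (invmx N *m (b - A *m (D_map A V w *m b))) +
  sqnorm (invmx N *m (A *m (D_map A V w *m b - y))).
Proof.
set x := D_map A V w *m b => yS.
have [c cE] : exists c, x - y = V *m c by apply/bV.1; rewrite memvB ?D_map_mem.
have -> : b - A *m y = (b - A *m x) + A *m (x - y).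
  by rewrite mulmxBr addrA subrK.
rewrite [invmx N *m (_ + A *m _)]mulmxDr sqnormD // cE.
have := congr1 (mulmx^~ c) (congr1 (@adjmx _ _ _ _) (normal_equation b)).
rewrite adjmx0 mul0mx !adjmxM adjmxK hA -invmx_sqrtmxK adjmxM adjmx_invmx_sqrtmx.
by rewrite !mulmxA.
Qed.

(** By Pythagoras [D_map A V w *m b] is a minimiser, and any minimiser chosen by [xget] has zero
    deviation from it, since [N] and [A] are invertible. *)
Lemma x_optE (b : 'cV[F]_n) : x_opt A S b w = D_map A V w *m b.
Proof.
rewrite /x_opt; set x := D_map A V w *m b.
case: xgetP => [z _ [zS zmin]|/(_ x)[]]; last first.
  split=> [|y yS]; first exact: D_map_mem.
  by rewrite /residual_norm norm2_le (sqnorm_residual b yS) lerDl sqnorm_ge0.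
have := zmin _ (D_map_mem b); rewrite /residual_norm norm2_le.
rewrite (sqnorm_residual b zS) gerDl => zx.
have : invmx N *m (A *m (x - z)) = 0.
  by apply: sqnorm_eq0; apply: le_anti; rewrite zx sqnorm_ge0.
move/(congr1 (mulmx N)); rewrite mulKVmx ?sqrtmx_unit // mulmx0.
move/(congr1 (mulmx (invmx A))); rewrite mulKmx // mulmx0.
by move/eqP; rewrite subr_eq0 => /eqP.
Qed.

End FixedShift.
End Optimum.

(** * Index zero against constancy and injectivity of [D_map] *)

Section Index.
Variables (R : realType) (K : base_field) (n p : nat).
Local Notation F := (scalars R K).
Variables (A : 'M[F]_n) (S : {vspace 'cV[F]_n}) (V : 'M[F]_(n, p)).
Hypothesis bV : basis_mx S V.

Lemma Ind_eq0 : Ind A S = 0%N <-> exists T : 'M[F]_p, A *m V = V *m T.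
Proof.
transitivity (image_subspace A S <= S)%VS.
  (* A truncated difference equal to 0 says that the sum has dimension at most that of [S], which
     forces it to be [S]. *)
  rewrite /Ind; split=> [/eqP|AS]; last by rewrite (addv_idPl AS) subnn.
  rewrite subn_eq0 => dS; apply/addv_idPl/esym/eqP.
  by rewrite eqEdim addvSl.
split=> [AS|[T AVT]].
  have /fin_all_exists[t tE] j : exists c, A *m col j V = V *m c.
    apply/bV.1; move/subvP: AS; apply.
    rewrite -[A *m _](lfunE (mulmx A : {linear 'cV[F]_n -> 'cV[F]_n})).
    by apply/memv_img/bV.1; exists (delta_mx j 0); rewrite colE.
  exists (\matrix_(i, j) t j i 0); apply/matrixP => i j.
  have /colP/(_ i) := tE j; rewrite !mxE => AVE.
  transitivity (\sum_k A i k * col j V k 0).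
    by apply: eq_bigr => k _; rewrite mxE.
  by rewrite AVE; apply: eq_bigr => k _; rewrite !mxE.
apply/subvP => _ /memv_imgP[y /bV.1[c ->] ->].
by rewrite lfunE /= mulmxA AVT; apply/bV.1; exists (T *m c); rewrite mulmxA.
Qed.

Lemma basis_mx_mulI q : injective (mulmx V : 'M[F]_(p, q) -> 'M_(n, q)).
Proof.
move=> X Y VXY; apply/matrixP => i j.
have /bV.2/colP/(_ i) : V *m (col j X - col j Y) = 0.
  by rewrite mulmxBr !colE !mulmxA VXY subrr.
by rewrite !mxE => /eqP; rewrite subr_eq0 => /eqP.
Qed.

Hypotheses (hA : is_hermitian A) (uA : A \in unitmx).

Lemma D_map_const T w1 w2 : A *m V = V *m T ->
  omega_min A < w1 -> omega_min A < w2 -> D_map A V w1 = D_map A V w2.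
Proof.
move=> AVT w1A w2A.
(* From [A_w V = V Tw] follows [A_w^-1 A V = V Tw^-1 T], whose adjoint gives [C]. [T] and [Tw] are
   invertible because [A] and [A_w] are injective on the range of [V]. *)
have AiV w : omega_min A < w -> exists2 C, C \in unitmx &
    adjmx V *m A *m invmx (shiftmx A w) = C *m adjmx V.
  move=> wA; have uAw := shiftmx_unit hA wA.
  pose Tw := T + (of_real R K w)%:M.
  have AVw : shiftmx A w *m V = V *m Tw.
    by rewrite mulmxDl mulmxDr AVT mul_scalar_mx mul_mx_scalar.
  have Vinj := bV.2.
  have uTw : Tw \in unitmx.
    apply: unitmx_inj => c Tc; apply: Vinj; apply: (can_inj (mulKmx uAw)).
    by rewrite mulmxA AVw -mulmxA Tc !mulmx0.
  have uT : T \in unitmx.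
    apply: unitmx_inj => c Tc; apply: Vinj; apply: (can_inj (mulKmx uA)).
    by rewrite mulmxA AVT -mulmxA Tc !mulmx0.
  have AwV : invmx (shiftmx A w) *m V = V *m invmx Tw.
    apply: (can_inj (mulKmx uAw)); rewrite mulKVmx // mulmxA AVw.
    by rewrite mulmxK.
  exists (adjmx (invmx Tw *m T)).
    by rewrite /adjmx map_unitmx unitmx_tr unitmx_mul unitmx_inv uTw.
  rewrite -adjmxM mulmxA -AwV -[_ *m V *m T]mulmxA -AVT mulmxA.
  by rewrite !adjmxM hA hermitian_invmx ?mulmxA //; exact: hermitian_shiftmx.
have DE w : omega_min A < w ->
    D_map A V w = V *m invmx (adjmx V *m A *m V) *m adjmx V.
  move=> wA; have [C uC CE] := AiV w wA.
  have := gram_unit hA uA bV wA; rewrite /D_map.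
  have -> (X : 'M[F]_p) : V *m X *m adjmx V *m A *m invmx (shiftmx A w) =
      V *m X *m C *m adjmx V.
    by rewrite -!mulmxA [adjmx V *m _]mulmxA CE.
  rewrite CE; set H := adjmx V *m A *m V.
  have -> : C *m adjmx V *m A *m V = C *m H by rewrite /H !mulmxA.
  (* [A] may be indefinite, so the invertibility of [H] is read off from the invertible Gram matrix
     [C *m H]. *)
  rewrite unitmx_mul => /andP[_ uH]; have uCH : C *m H \in unitmx.
    by rewrite unitmx_mul uC.
  congr (_ *m _); rewrite -mulmxA; congr (_ *m _).
  by rewrite -[LHS](mulmxK uH) -(mulmxA _ C H) mulVmx // mul1mx.
by rewrite !DE.
Qed.

Lemma D_map_inj w1 w2 : omega_min A < w1 -> omega_min A < w2 -> w1 <> w2 ->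
  D_map A V w1 = D_map A V w2 -> exists T : 'M[F]_p, A *m V = V *m T.
Proof.
move=> w1A w2A w12; have Vinj := bV.2; pose H := adjmx V.
pose A1 := shiftmx A w1; pose A2 := shiftmx A w2.
have uA1 : A1 \in unitmx by exact: shiftmx_unit.
have uA2 : A2 \in unitmx by exact: shiftmx_unit.
rewrite /D_map; have := gram_unit hA uA bV w1A.
set G1 := H *m A *m invmx A1 *m A *m V => uG1.
set G2 := adjmx V *m A *m invmx (shiftmx A w2) *m A *m V => D12.
have {D12} : invmx G1 *m (H *m A *m invmx A1) = invmx G2 *m (H *m A *m invmx A2).
  by apply: basis_mx_mulI; rewrite !mulmxA.
pose C := G1 *m invmx G2; move/(congr1 (mulmx G1)).
rewrite mulKVmx // (mulmxA G1) -/C => D12.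
(* Shifts of [A] commute with [A] and with each other, which allows cancelling [A] on the right and
   clearing both inverses. *)
have cshift w M : A *m M = M *m A -> shiftmx A w *m M = M *m shiftmx A w.
  by move=> cM; rewrite /shiftmx mulmxDl mulmxDr scalar_mxC cM.
have cA12 : A1 *m A2 = A2 *m A1 := cshift w1 A2 (esym (cshift w2 A erefl)).
have cA w : shiftmx A w \in unitmx ->
    A *m invmx (shiftmx A w) = invmx (shiftmx A w) *m A.
  move=> uAw; apply: (can_inj (mulKmx uAw)); rewrite mulKVmx // mulmxA.
  by rewrite cshift // mulmxK.
have {D12} D12 : H *m invmx A1 = C *m H *m invmx A2.
  apply: (can_inj (mulmxK uA)).
  by move: D12; rewrite -!mulmxA -(cA w1) // -(cA w2).
have HA21 : H *m A2 = C *m H *m A1.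
  have := congr1 (mulmx^~ (A1 *m A2)) D12; rewrite /= mulmxA mulmxKV // => ->.
  by rewrite cA12 mulmxA mulmxKV.
have HC : (1%:M - C) *m H *m A =
    ((of_real R K w1) *: C - (of_real R K w2)%:M) *m H.
  move: HA21; rewrite /A1 /A2 /shiftmx !mulmxDr !mul_mx_scalar => HA21.
  rewrite 3!mulmxBl mul1mx mul_scalar_mx -scalemxAl.
  by apply/eqP; rewrite subr_eq addrAC eq_sym subr_eq HA21 addrC.
(* For [y] the adjoint of a null vector, [y C = y]; multiplying [HC] by [y] leaves
   [(w1 - w2) y V^* = 0], so [y = 0]. *)
have uC : 1%:M - C \in unitmx.
  suff : adjmx (1%:M - C) \in unitmx by rewrite /adjmx map_unitmx unitmx_tr.
  apply: unitmx_inj => c /(congr1 (@adjmx _ _ _ _)); rewrite adjmxM adjmxK adjmx0.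
  rewrite mulmxBr mulmx1 => /eqP; rewrite subr_eq0 => /eqP cC.
  have := congr1 (mulmx (adjmx c)) HC.
  rewrite !mulmxA !mulmxBr mulmx1 -cC subrr !mul0mx.
  rewrite -scalemxAr -cC mul_mx_scalar -scalerBl -scalemxAl => /esym/eqP.
  rewrite scaler_eq0 subr_eq0 fmorph_eq => /orP[/eqP//|/eqP cH].
  by apply: Vinj; rewrite -[LHS]adjmxK adjmxM cH adjmx0.
(* Solve [HC] for [V^* A] and take adjoints, [A] being Hermitian. *)
exists (adjmx (invmx (1%:M - C) *m ((of_real R K w1) *: C - (of_real R K w2)%:M))).
rewrite -[LHS]adjmxK -[RHS]adjmxK; congr adjmx.
by rewrite !adjmxM !adjmxK hA -mulmxA -HC -mulmxA mulKmx.
Qed.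

End Index.

(** * Assembly of the three statements *)

Theorem corollary4p2 (R : realType) (K : base_field) (n p : nat)
    (A : 'M[scalars R K]_n) (S : {vspace 'cV[scalars R K]_n})
    (hA : is_hermitian A) (uA : A \in unitmx)
    (dimS : \dim S = p) (p_ge1 : (1 <= p)%N) (p_le : (p <= n)%N) :
  [/\ Ind A S = 0%N <-> \dim (X_lin A S) = 0%N,
      Ind A S = 0%N <-> (forall b : 'cV[scalars R K]_n,
                            affine_dim (X_aff A S b) = 0%N)
    & forall V : 'M[scalars R K]_(n, p), orthonormal_basis_mx S V ->
        (Ind A S = 0%N ->
           forall w1 w2 : R, omega_min A < w1 -> omega_min A < w2 ->
             D_map A V w1 = D_map A V w2) /\
        (Ind A S <> 0%N ->
           forall w1 w2 : R, omega_min A < w1 -> omega_min A < w2 ->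
             D_map A V w1 = D_map A V w2 -> w1 = w2)].
Proof.
have dim0 (U : {vspace 'cV[scalars R K]_n}) : \dim U = 0%N <-> U = 0%VS.
  by split=> [/eqP|->]; rewrite ?dimv0 // dimv_eq0 => /eqP.
have X_linE : \dim (X_lin A S) = 0%N <->
    forall b, affine_dim (X_aff A S b) = 0%N.
  by rewrite dim0 sum_subspaces_eq0; split=> X0 b; exact/dim0/X0.
have X_affE : Ind A S = 0%N <-> forall b, affine_dim (X_aff A S b) = 0%N.
  have [V bV] := ex_basis_mx dimS; split=> [/(Ind_eq0 A bV)[T AVT] b|X0].
    apply/dim0/direction_affine_hull_eq0 => _ _ [w1 w1A <-] [w2 w2A <-].
    by rewrite !(x_optE hA uA bV) // (D_map_const bV hA uA AVT w1A w2A).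
  (* Any two distinct admissible shifts would do: one coincidence of [D_map] already forces index
     zero. *)
  pose w1 := omega_min A + 1; pose w2 := omega_min A + 2.
  have w1A : omega_min A < w1 by rewrite ltrDl.
  have w2A : omega_min A < w2 by rewrite ltrDl.
  apply/(Ind_eq0 A bV)/(D_map_inj bV hA uA w1A w2A).
    by move/addrI/eqP; rewrite (eqr_nat R 1 2).
  (* Trivial directions make the minimisers for [w1] and [w2] agree for every [b]; taking [b] to be
     the unit vectors compares the matrices by columns. *)
  have D12 (b : 'cV_n) : D_map A V w1 *m b = D_map A V w2 *m b.
    rewrite -(x_optE hA uA bV w1A) -(x_optE hA uA bV w2A).
    by have /dim0/direction_affine_hull_eq0 := X0 b; apply; [exists w1|exists w2].
  apply/matrixP => i j; have /colP/(_ i) := D12 (delta_mx j 0).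
  by rewrite -!colE !mxE.
split=> [|//|V /orthonormal_basis_mxW bV].
  exact: iff_trans X_affE (iff_sym X_linE).
split.
  move=> /(Ind_eq0 A bV)[T AVT] w1 w2 w1A w2A.
  exact: (D_map_const bV hA uA AVT w1A w2A).
move=> Ind0 w1 w2 w1A w2A D12; apply: contra_notP Ind0 => w12.
exact/(Ind_eq0 A bV)/(D_map_inj bV hA uA w1A w2A w12).
Qed.
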